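(* Let $k\ge1$, let $\alpha\ge1$ be any finite approximation factor, and let $\|\cdot\|$ be any function on real vectors (of any dimension) that evaluates to $0$ on the all-zeros vector and to a positive number on every other vector. For every $n>9$ there is a matrix $A\in\mathbb{R}^{n\times n}$ such that there is no sampling matrix $S\in\mathbb{R}^{m\times n}$ with $m<n$ satisfying $\alpha^{-1}\|Ax\|\le\|SAx\|\le\alpha\|Ax\|$ for all $x\in\Psi_k$.
   Context: $\Psi_k=\{x\in\mathbb{R}^n:\|x\|_0\le k\}$. A sampling matrix is a matrix each of whose rows is a (possibly reweighted) standard basis vector. *)

(* Defs.v *)
From mathcomp Require Import all_boot all_order all_algebra.
From mathcomp Require Import reals.
Set Implicit Arguments.
Unset Strict Implicit.
Unset Printing Implicit Defensive.
Import Order.TTheory GRing.Theory Num.Theory.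
Local Open Scope ring_scope.

Definition l0norm (R : realType) (n : nat) (x : 'cV[R]_n) : nat :=
  #|[set i : 'I_n | x i 0 != 0]|.

Definition Psi (R : realType) (n k : nat) : {pred 'cV[R]_n} :=
  [pred x | (l0norm x <= k)%N].

(* The weights are arbitrary reals, so rows of weight zero are allowed. *)
Definition sampling_matrix (R : realType) (m n : nat) (S : 'M[R]_(m, n)) : Prop :=
  forall i : 'I_m, exists (j : 'I_n) (w : R), row i S = w *: delta_mx 0 j.

(* Main.v *)
(* The identity matrix is a witness: a sampling matrix with fewer than n rows
   misses some coordinate j, hence kills the 1-sparse vector e_j, so the lower
   bound would force N e_j <= 0. *)
Require Import Defs.
From mathcomp Require Import all_boot all_order all_algebra.
From mathcomp Require Import reals.
Set Implicit Arguments.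
Unset Strict Implicit.
Unset Printing Implicit Defensive.
Import Order.TTheory GRing.Theory Num.Theory.
Local Open Scope ring_scope.

(** Take [A] to be the identity. Each row of [S] has at most one nonzero entry, so by pigeonhole
    fewer than [n] rows leave some column [j] zero, and [S] annihilates the 1-sparse vector e_j. The
    lower bound at e_j would put a positive number below [N m 0 = 0], whatever the finite distortion
    [alpha]. *)

Lemma sampling_matrix_col0 (R : realType) (m n : nat) (S : 'M[R]_(m, n)) :
  (m < n)%N -> sampling_matrix S -> exists j : 'I_n, col j S = 0.
Proof.
move=> mn samS; case: (pickP (fun j => col j S == 0)) => [j /eqP Sj0|colN0].
  by exists j.
(* If no column vanishes, [f] picks for each column a row where it is nonzero. *)
have /fin_all_exists [f fP] (j : 'I_n) : exists i, S i j != 0.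
  apply/existsP; apply: contraFT (colN0 j) => /existsPn Sj0.
  by apply/eqP/colP => i; rewrite !mxE; apply/eqP; rewrite -[_ == _]negbK Sj0.
have f_inj : injective f.
  move=> j1 j2 f12; have [j [w Sw]] := samS (f j1).
  (* A multiple of a basis vector is nonzero in at most one place, so two columns sharing a row
     coincide; an injective [f] contradicts [m < n]. *)
  have SE l : S (f j1) l != 0 -> l = j.
    have -> : S (f j1) l = row (f j1) S 0 l by rewrite mxE.
    by rewrite Sw !mxE eqxx /=; case: (eqVneq l j) => // _; rewrite mulr0 eqxx.
  by rewrite (SE j1 (fP j1)) (SE j2) // f12.
by have := leq_card f f_inj; rewrite !card_ord leqNgt mn.
Qed.

Lemma delta_mx_Psi (R : realType) (n k : nat) (j : 'I_n) :
  (1 <= k)%N -> (delta_mx j 0 : 'cV[R]_n) \in Psi k.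
Proof.
move=> k1; rewrite inE; apply: leq_trans k1.
rewrite /l0norm -[leqRHS](cards1 j).
apply/subset_leq_card/subsetP => i; rewrite !inE mxE eqxx andbT.
by case: (i == j); rewrite // eqxx.
Qed.

Theorem theorem4 (R : realType) (k : nat) (hk : (1 <= k)%N)
    (alpha : R) (halpha : 1 <= alpha)
    (N : forall d : nat, 'cV[R]_d -> R)
    (N0 : forall d : nat, N d 0 = 0)
    (Npos : forall (d : nat) (x : 'cV[R]_d), x != 0 -> 0 < N d x)
    (n : nat) (hn : (9 < n)%N) :
  exists A : 'M[R]_(n, n),
    ~ exists (m : nat) (S : 'M[R]_(m, n)),
        [/\ (m < n)%N,
            sampling_matrix S
          & forall x : 'cV[R]_n, x \in Psi k ->
              alpha^-1 * N n (A *m x) <= N m (S *m A *m x)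
              /\ N m (S *m A *m x) <= alpha * N n (A *m x)].
Proof.
exists 1%:M => -[m [S [mn samS SN]]].
have [j Sj0] := sampling_matrix_col0 mn samS.
have [+ _] := SN _ (delta_mx_Psi R j hk).
(* [S] sends e_j to its zero column [j], so it remains to show [alpha^-1 * N n e_j] positive. *)
rewrite mulmx1 mul1mx -colE Sj0 N0 leNgt => /negP; apply.
apply: mulr_gt0; first by rewrite invr_gt0 (lt_le_trans ltr01).
apply: Npos; apply/eqP => /matrixP/(_ j 0)/eqP.
by rewrite !mxE !eqxx oner_eq0.
Qed.
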